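(* Let $S:\widetilde V'\to\widetilde V$ be symmetric and positive-definite with $\lambda_{\max}(SA)\le\lambda$, and assume that $$\|\tilde u_h-u_h\|_{S^{-1}}\le\sqrt\delta\,\|\tilde u_h-u_h\|_a,$$ where $\delta>0$ is a constant. Let $m\ge1$ be an integer and let $R_mu_h$ be the output of $m$ steps of the preconditioned conjugate gradient iteration with preconditioner $S$ and initial guess $u_h$ (defined in the context). Then $$\|u-R_mu_h\|_a\le(1+\varepsilon_m)\|u-\tilde u_h\|_a+\varepsilon_m\|u-u_h\|_a,\qquad \varepsilon_m=\frac{\sqrt{\lambda\delta}}{2m+1}.$$
   Context: $V\subset\widetilde V$ are finite-dimensional real vector spaces (finite element spaces), and $a:\widetilde V\times\widetilde V\to\mathbb R$ is a symmetric, coercive (positive-definite) bilinear form with energy norm $\|v\|_a=\sqrt{a(v,v)}$. $\widetilde V'$ is the dual of $\widetilde V$ and $\langle\cdot,\cdot\rangle$ the duality pairing. The operator $A:\widetilde V\to\widetilde V'$ is defined by $\langle Av,w\rangle=a(v,w)$. Given $f\in V'$ and $\tilde f\in\widetilde V'$ with $\tilde f|_V=f$, $u_h\in V$ solves $a(u_h,v)=f(v)$ for all $v\in V$, and $\tilde u_h\in\widetilde V$ solves $a(\tilde u_h,v)=\tilde f(v)$ for all $v\in\widetilde V$. The element $u$ is the exact solution being approximated; it may lie outside $\widetilde V$, and $\|\cdot\|_a$ is understood to extend to a seminorm on $\widetilde V+\mathrm{span}\{u\}$ that agrees with the energy norm on $\widetilde V$. A linear operator $S:\widetilde V'\to\widetilde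 V$ is symmetric and positive-definite if $\langle g_1,Sg_2\rangle=\langle g_2,Sg_1\rangle$ for all $g_1,g_2\in\widetilde V'$ and $\langle g,Sg\rangle>0$ for all $0\ne g\in\widetilde V'$. Then $\|v\|_{S^{-1}}=\langle S^{-1}v,v\rangle^{1/2}$, and $\lambda_{\max}(SA)$ is the largest eigenvalue of $SA$, which is self-adjoint and positive-definite with respect to $(v,w)_{S^{-1}}=\langle S^{-1}v,w\rangle$. Preconditioned conjugate gradient iteration: set $u_0=u_h$, $r_0=\tilde f-Au_h$, $p_0=z_0=Sr_0$. For $k=1,\dots,m$: $\alpha_k=\langle r_{k-1},z_{k-1}\rangle/\langle Ap_{k-1},p_{k-1}\rangle$; $u_k=u_{k-1}+\alpha_kp_{k-1}$; $r_k=r_{k-1}-\alpha_kAp_{k-1}$; $z_k=Sr_k$; $\beta_k=\langle r_k,z_k\rangle/\langle r_{k-1},z_{k-1}\rangle$; $p_k=z_k+\beta_kp_{k-1}$. The output is $R_mu_h=u_m$. If some residual $r_{k}$ vanishes, the iteration stops and the current iterate $u_k$ is returned as $R_mu_h$. *)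

(* Defs.v *)
From HB Require Import structures.
From mathcomp Require Import all_boot all_order all_algebra.
From mathcomp Require Import classical_sets reals.

Set Implicit Arguments.
Unset Strict Implicit.
Unset Printing Implicit Defensive.

Import Order.TTheory GRing.Theory Num.Theory.
Local Open Scope ring_scope.

Definition dual (R : realType) (W : vectType R) := 'Hom(W, R^o).

Definition pairing (R : realType) (W : vectType R) (g : dual W) (v : W) : R :=
  g v.

(* A symmetric positive-definite bilinear form on [W] is an element of
   [{dot W for idfun}]. *)

Definition energy_norm (R : realType) (W : vectType R) (a : {dot W for idfun})
    (v : W) : R :=
  Num.sqrt (a v v).

(* [linfun] is only meaningful on linear maps: [energy_opE] below shows that
   this is the operator A given by <A v, w> = a(v, w). *)
Definition energy_op (R : realType) (W : vectType R) (a : {dot W for idfun}) :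
    'Hom(W, dual W) :=
  linfun (fun v => linfun (fun w => a v w : R^o) : dual W).

Lemma energy_opE (R : realType) (W : vectType R) (a : {dot W for idfun})
    (v w : W) :
  pairing (energy_op a v) w = a v w.
Proof.
have linr x : linear (fun y => a x y : R^o).
  by move=> c y z; rewrite linearPr.
have E x y : linfun (fun z => a x z : R^o) y = a x y.
  pose F := GRing.isLinear.Build _ _ _ _ (fun y => a x y : R^o) (linr x).
  pose f : {linear W -> R^o} := HB.pack (fun y => a x y : R^o) F.
  exact: (lfunE f).
have linl : linear (fun x => linfun (fun y => a x y : R^o) : dual W).
  move=> c x y; apply/lfunP => z.
  by rewrite add_lfunE scale_lfunE !E linearPl.
pose F := GRing.isLinear.Build _ _ _ _
  (fun x => linfun (fun y => a x y : R^o) : dual W) linl.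
pose f : {linear W -> dual W} :=
  HB.pack (fun x => linfun (fun y => a x y : R^o) : dual W) F.
by rewrite /pairing /energy_op (lfunE f) /= E.
Qed.

Definition spd_op (R : realType) (W : vectType R) (S : 'Hom(dual W, W)) : Prop :=
  (forall g1 g2 : dual W, pairing g1 (S g2) = pairing g2 (S g1)) /\
  (forall g : dual W, g != 0 -> 0 < pairing g (S g)).

(* [S^-1%VF] is the two-sided inverse of [S] when [S] is bijective, which is
   the case whenever [spd_op S]. *)
Definition precond_norm (R : realType) (W : vectType R) (S : 'Hom(dual W, W))
    (v : W) : R :=
  Num.sqrt (pairing ((S^-1)%VF v) v).

(* The spectrum is finite, so this supremum is the largest real eigenvalue of
   [phi] as soon as [phi] has one (and 0 if it has none, e.g. if W = 0). *)
Definition lambda_max (R : realType) (W : vectType R) (phi : 'End(W)) : R :=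
  sup [set mu : R | passmx.leigenvalue phi mu]%classic.

Record pcg_state (R : realType) (W : vectType R) := PCGState {
  pcg_u : W;
  pcg_r : dual W;
  pcg_z : W;
  pcg_p : W
}.

Section PCG.
Context {R : realType} {W : vectType R}.
Variables (S : 'Hom(dual W, W)) (A : 'Hom(W, dual W)).

Definition pcg_init (g : dual W) (u0 : W) : pcg_state W :=
  let r0 := g - A u0 in
  let z0 := S r0 in
  PCGState u0 r0 z0 z0.

(* A vanishing residual freezes the state, so that iterating further returns
   the iterate at which the algorithm stops. *)
Definition pcg_step (s : pcg_state W) : pcg_state W :=
  let: PCGState u r z p := s in
  if r == 0 then s else
  let alpha := pairing r z / pairing (A p) p in
  let u' := u + alpha *: p in
  let r' := r - alpha *: A p in
  let z' := S r' in
  let beta := pairing r' z' / pairing r z in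
  PCGState u' r' z' (z' + beta *: p).

Definition pcg (m : nat) (g : dual W) (u0 : W) : W :=
  pcg_u (iter m pcg_step (pcg_init g u0)).

End PCG.

Definition seminorm_on (R : realType) (X : lmodType R) (D : set X)
    (N : X -> R) : Prop :=
  (forall x y : X, D x -> D y -> N (x + y) <= N x + N y) /\
  (forall (c : R) (x : X), D x -> N (c *: x) = `|c| * N x).

Definition add_span (R : realType) (W X : lmodType R) (iota : W -> X) (u : X) :
    set X :=
  [set x : X | exists (v : W) (c : R), x = iota v + c *: u]%classic.

Definition pcg_eps (R : realType) (lambda delta : R) (m : nat) : R :=
  Num.sqrt (lambda * delta) / (2 * m + 1)%:R.

(* Main.v *)
Require Import Defs.
From HB Require Import structures.
From mathcomp Require Import all_boot all_order all_algebra.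
From mathcomp Require Import classical_sets reals.
From mathcomp Require Import ring lra.

(** Write [e = ut - uh], [T = S^-1] and [<B v, w>] for a form given by a map
    [B] into the dual. Three facts carry the estimate.

    Rayleigh quotients ([form_le_lambda_max]): [<A v, v>] is at most
    [lambda_max (S A) <T v, v>]. The supremum of the quotients
    [<A v, v> / <T v, v>] is attained at an eigenvector of [S A].

    Optimality of conjugate gradients ([pcg_error_min]): among all vectors
    [y = q(S A) e] with [q] a polynomial of degree at most [m] and [q(0) = 1],
    the error [ut - u_m] has the smallest energy. Hence any such [q] gives an
    upper bound.

    Choice of [q] ([pcg_energy_bound]): with [x^2 = mu / lambda], take
    [q(mu) = (-1)^m T_(2m+1)(x) / ((2m+1) x)], where [T_n] is the Chebyshev
    polynomial of the first kind. Then [mu q(mu)^2 = lambda T_(2m+1)(x)^2 / (2m+1)^2],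
    which is at most [lambda / (2m+1)^2] on [0, lambda]. The bound
    [T_(2m+1)(x)^2 <= 1] comes from the Pell identity
    [T_(2m+1)(x)^2 + (1 - x^2) U_(2m)(x)^2 = 1], which is an identity between
    polynomials in [x^2] and so makes sense with the operator [S A / lambda] in
    place of [x^2] ([cheb_energy]). Since [1 - S A / lambda] is nonnegative by
    the Rayleigh bound, it yields
    [<A q(S A) e, q(S A) e> <= lambda / (2m+1)^2 <T e, e>] directly.

    With the hypothesis [<T e, e> <= delta <A e, e>] this says that the method
    contracts the error by [sqrt (lambda delta) / (2m+1)], and two triangle
    inequalities ([extended_triangle]) give the theorem. *)

Set Implicit Arguments.
Unset Strict Implicit.
Unset Printing Implicit Defensive.

Import Order.TTheory GRing.Theory Num.Theory.
Local Open Scope ring_scope.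

(** * Functionals and forms *)

Section DualPairing.
Variables (R : realType) (W : vectType R).
Implicit Types (g h : dual W) (v w : W) (c : R).

Lemma pairingDl g h v : pairing (g + h) v = pairing g v + pairing h v.
Proof. by rewrite /pairing add_lfunE. Qed.

Lemma pairingNl g v : pairing (- g) v = - pairing g v.
Proof. by rewrite /pairing opp_lfunE. Qed.

Lemma pairingZl c g v : pairing (c *: g) v = c * pairing g v.
Proof. by rewrite /pairing scale_lfunE. Qed.

Lemma pairing0l v : pairing (0 : dual W) v = 0.
Proof. by rewrite /pairing zero_lfunE. Qed.

Lemma pairingDr g v w : pairing g (v + w) = pairing g v + pairing g w.
Proof. by rewrite /pairing linearD. Qed.

Lemma pairingNr g v : pairing g (- v) = - pairing g v.
Proof. by rewrite /pairing linearN. Qed.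

Lemma pairingZr c g v : pairing g (c *: v) = c * pairing g v.
Proof. by rewrite /pairing linearZ. Qed.

Lemma pairing0r g : pairing g 0 = 0.
Proof. by rewrite /pairing linear0. Qed.

Definition pairingE := (pairingDl, pairingNl, pairingZl, pairing0l,
                        pairingDr, pairingNr, pairingZr, pairing0r).

Lemma dim_dual : dim (dual W) = dim W.
Proof. exact: muln1. Qed.

(** Reduces an identity between linear combinations of vectors to a scalar
    identity, which [ring] decides. *)
Lemma pairing_separates v w : (forall g : dual W, pairing g v = pairing g w) -> v = w.
Proof.
move=> eq_vw; rewrite (coord_vbasis (memvf v)) (coord_vbasis (memvf w)).
apply: eq_bigr => i _; congr (_ *: _).
by have := eq_vw (linfun (coord (vbasis {:W}) i : W -> R^o)); rewrite /pairing !lfunE.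
Qed.

End DualPairing.

Lemma limg_injective_full (K : fieldType) (U V : vectType K) (f : 'Hom(U, V)) :
  dim U = dim V -> lker f == 0%VS -> limg f = fullv.
Proof.
move=> dimUV /eqP kerf0; apply/eqP.
by rewrite eqEdim subvf limg_dim_eq ?kerf0 ?capv0 // !dimvf dimUV leqnn.
Qed.

Section Forms.
Variables (R : realType) (W : vectType R).
Implicit Types (B G : 'Hom(W, dual W)) (v w : W).

Definition sym_form B := forall v w, pairing (B v) w = pairing (B w) v.
Definition psd_form B := forall v, 0 <= pairing (B v) v.
Definition posdef_form B := forall v, v != 0 -> 0 < pairing (B v) v.

Lemma posdef_psd B : posdef_form B -> psd_form B.
Proof.
move=> Bpos v; have [->|/Bpos/ltW //] := eqVneq v 0.
by rewrite pairing0r.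
Qed.

(** The form may be degenerate, so the usual division by [<B w, w>] needs the
    separate case where [<B w, w> = 0]. *)
Lemma form_cauchy_schwarz B v w : sym_form B -> psd_form B ->
  pairing (B v) w ^+ 2 <= pairing (B v) v * pairing (B w) w.
Proof.
move=> Bsym Bpsd; set b := pairing (B v) w.
set p := pairing (B v) v; set q := pairing (B w) w.
have key c d : 0 <= c ^+ 2 * p + 2 * (c * d * b) + d ^+ 2 * q.
  have := Bpsd (c *: v + d *: w).
  rewrite linearD !linearZ /= !pairingE (Bsym w v) -/b -/p -/q.
  by congr (0 <= _); ring.
have p_ge0 : 0 <= p := Bpsd v.
have q_ge0 : 0 <= q := Bpsd w.
(* [(q, - b)] is, up to scaling, the minimizer when [q > 0];
   [(b, - (p + 1))] forces [b = 0] when [q = 0]. *)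
have := key q (- b); have := key b (- (p + 1)).
have [-> //|q_neq0] := eqVneq q 0; first by nra.
have q_gt0 : 0 < q by rewrite lt_neqAle eq_sym q_neq0.
move=> _ h; have {}h : 0 <= q * (p * q - b ^+ 2) by move: h; congr (0 <= _); ring.
by move: h; rewrite pmulr_rge0 // subr_ge0.
Qed.

(** Every functional is [B w] for some [w], and by the Cauchy-Schwarz
    inequality its square is then bounded by a multiple of [B]; any other form
    is a finite sum of products of two functionals. *)
Lemma form_le_nondegenerate B G : sym_form B -> psd_form B ->
  lker B == 0%VS -> sym_form G ->
  exists C : R, forall v, pairing (G v) v <= C * pairing (B v) v.
Proof.
move=> Bsym Bpsd kerB0 Gsym.
have prod_bound (phi psi : dual W) :
    exists C : R, forall v, pairing phi v * pairing psi v <= C * pairing (B v) v.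
  have fullB := limg_injective_full (esym (dim_dual W)) kerB0.
  have Briesz g : exists w, g = B w.
    have /memv_imgP[w _ ->] : g \in limg B by rewrite fullB memvf.
    by exists w.
  have [x ->] := Briesz phi; have [y ->] := Briesz psi.
  exists (2^-1 * (pairing (B x) x + pairing (B y) y)) => v.
  have := form_cauchy_schwarz x v Bsym Bpsd.
  have := form_cauchy_schwarz y v Bsym Bpsd.
  have := sqr_ge0 (pairing (B x) v - pairing (B y) v).
  by move: (pairing (B x) v) (pairing (B y) v) => s t; lra.
pose e := vbasis {:W}.
pose phi i : dual W := linfun (coord e i : W -> R^o).
have phiE i v : pairing (phi i) v = coord e i v by rewrite /pairing lfunE.
have expand v :
    pairing (G v) v = \sum_i pairing (phi i) v * pairing (G e`_i) v.
  rewrite {2}(coord_vbasis (memvf v)) /pairing linear_sum.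
  apply: eq_bigr => i _; rewrite linearZ -!/(pairing _ _) phiE.
  by congr (_ * _); apply: Gsym.
have /fin_all_exists[C leC] i := prod_bound (phi i) (G e`_i).
exists (\sum_i C i) => v.
by rewrite expand mulr_suml; apply: ler_sum => i _; apply: leC.
Qed.

End Forms.

(** * The largest generalized eigenvalue *)

Section Rayleigh.
Variables (R : realType) (W : vectType R).
Implicit Types (A T : 'Hom(W, dual W)) (v w : W).

Lemma posdef_lker0 T : posdef_form T -> lker T == 0%VS.
Proof.
move=> Tpos; rewrite -subv0; apply/subvP => v; rewrite memv_ker memv0 => /eqP Tv0.
by apply: contraT => /Tpos; rewrite Tv0 pairing0l ltxx.
Qed.

(** The supremum [M] of the Rayleigh quotients is attained: otherwise the
    positive semidefinite form [M T - A] is nondegenerate, hence dominates a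
    positive multiple of [T], and [M] could be lowered. *)
Lemma max_generalized_eigenvalue A T v0 :
  sym_form A -> sym_form T -> posdef_form T -> v0 != 0 ->
  exists M : R, (exists2 v, v != 0 & A v = M *: T v) /\
    (forall w, pairing (A w) w <= M * pairing (T w) w).
Proof.
move=> Asym Tsym Tpos v0_neq0.
have Tpsd := posdef_psd Tpos.
pose E := [set t : R |
  exists2 v, v != 0 & t = pairing (A v) v / pairing (T v) v]%classic.
have quotient_ub x w : ubound E x -> pairing (A w) w <= x * pairing (T w) w.
  move=> ubx; have [->|w_neq0] := eqVneq w 0; first by rewrite !pairing0r mulr0.
  by rewrite -ler_pdivrMr ?Tpos //; apply: ubx; exists w.
have E_neq0 : (E !=set0)%classic.
  by exists (pairing (A v0) v0 / pairing (T v0) v0), v0.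
have E_ub : has_ubound E.
  have [C leC] := form_le_nondegenerate Tsym Tpsd (posdef_lker0 Tpos) Asym.
  by exists C => _ [v v_neq0 ->]; rewrite ler_pdivrMr ?Tpos.
have ub_sup : ubound E (sup E) by apply: ub_le_sup.
exists (sup E); split; last by move=> w; apply: quotient_ub.
pose B := sup E *: T - A.
have BE v w : pairing (B v) w = sup E * pairing (T v) w - pairing (A v) w.
  by rewrite /B add_lfunE opp_lfunE scale_lfunE !pairingE.
have Bsym : sym_form B by move=> v w; rewrite !BE Tsym Asym.
have Bpsd : psd_form B by move=> v; rewrite BE subr_ge0 quotient_ub.
have [kerB0|] := boolP (lker B == 0%VS); last first.
  rewrite -vpick0 => v_neq0; exists (vpick (lker B)) => //; apply/eqP.
  have := memv_pick (lker B).
  by rewrite memv_ker /B add_lfunE opp_lfunE scale_lfunE subr_eq0 eq_sym.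
have [C leC] := form_le_nondegenerate Bsym Bpsd kerB0 Tsym.
have C_gt0 : 0 < C.
  have := lt_le_trans (Tpos _ v0_neq0) (leC v0).
  by have := Bpsd v0; set b := pairing _ _ => b_ge0; nra.
(* [T <= C (M T - A)] means [A <= (M - 1 / C) T]. *)
have : sup E <= sup E - C^-1.
  apply: ge_sup => // _ [v v_neq0 ->]; rewrite ler_pdivrMr ?Tpos //.
  rewrite mulrBl lerBrDl -lerBrDr -BE mulrC ler_pdivrMr // mulrC.
  exact: leC.
by rewrite lerBrDl gerDr leNgt invr_gt0 C_gt0.
Qed.

End Rayleigh.

Section Preconditioner.
Variables (R : realType) (W : vectType R) (S : 'Hom(dual W, W)).
Hypothesis S_spd : spd_op S.

Lemma spd_op_lker0 : lker S == 0%VS.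
Proof.
rewrite -subv0; apply/subvP => g; rewrite memv_ker memv0 => /eqP Sg0.
by apply: contraT => /S_spd.2; rewrite Sg0 pairing0r ltxx.
Qed.

Lemma spd_opVK : cancel (S^-1)%VF S.
Proof.
move=> v; rewrite limg_lfunVK //.
by rewrite (limg_injective_full (dim_dual W) spd_op_lker0) memvf.
Qed.

Lemma spd_opK : cancel S (S^-1)%VF.
Proof. exact/lker0_lfunK/spd_op_lker0. Qed.

Lemma spd_inv_sym : sym_form (S^-1)%VF.
Proof. by move=> v w; rewrite -{1}(spd_opVK w) S_spd.1 spd_opVK. Qed.

Lemma spd_inv_posdef : posdef_form (S^-1)%VF.
Proof.
move=> v v_neq0; rewrite -{2}(spd_opVK v); apply: S_spd.2.
by apply: contraNneq v_neq0 => Sv0; rewrite -(spd_opVK v) Sv0 linear0.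
Qed.

(** The maximizer [M] of the Rayleigh quotients is an eigenvalue of [S A]. It
    also bounds all the others, without which the supremum in [lambda_max]
    could not be compared with its elements. *)
Lemma form_le_lambda_max (A : 'Hom(W, dual W)) v : sym_form A ->
  pairing (A v) v <= lambda_max (S \o A)%VF * pairing ((S^-1)%VF v) v.
Proof.
move=> Asym; have [->|v_neq0] := eqVneq v 0; first by rewrite !pairing0r mulr0.
have [M [[e e_neq0 Ae] leM]] :=
  max_generalized_eigenvalue Asym spd_inv_sym spd_inv_posdef v_neq0.
apply: le_trans (leM v) _.
rewrite ler_wpM2r ?(posdef_psd spd_inv_posdef) //; apply: ub_le_sup.
  exists M => mu; rewrite /= /passmx.leigenvalue -vpick0.
  have := memv_pick (passmx.leigenspace (S \o A)%VF mu).
  set w := vpick _; rewrite memv_ker add_lfunE opp_lfunE scale_lfunE id_lfunE.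
  rewrite comp_lfunE subr_eq0 => /eqP SAw w_neq0.
  have := leM w; rewrite -(spd_opK (A w)) SAw linearZ !pairingE.
  by rewrite ler_pM2r // spd_inv_posdef.
rewrite /= /passmx.leigenvalue -subv0; apply: contra e_neq0 => /subvP/(_ e).
rewrite memv0; apply; rewrite memv_ker add_lfunE opp_lfunE scale_lfunE id_lfunE.
by rewrite comp_lfunE Ae linearZ /= spd_opVK subrr.
Qed.

End Preconditioner.

(** * Optimality of the conjugate gradient iterates *)

Section Krylov.
Variables (K : fieldType) (W : vectType K) (L : 'End(W)) (v : W).

(** The span of [v, L v, ..., L^(k-1) v], by a recursion that makes its
    stability under [L] immediate. *)
Fixpoint krylov (k : nat) : {vspace W} :=
  if k is j.+1 then (<[v]> + L @: krylov j)%VS else 0%VS.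

Lemma krylov_seed k : v \in krylov k.+1.
Proof. by rewrite /=; apply: (subvP (addvSl _ _)); apply: memv_line. Qed.

Lemma krylov_stable k x : x \in krylov k -> L x \in krylov k.+1.
Proof. by move=> xk; apply: (subvP (addvSr _ _)); apply: memv_img. Qed.

Lemma krylovS k : (krylov k <= krylov k.+1)%VS.
Proof. by elim: k => [|k IHk]; [apply: sub0v | apply: addvS (limgS _ IHk)]. Qed.

Lemma krylovS_sub k (U : {vspace W}) :
  v \in U -> {in krylov k, forall x, L x \in U} -> (krylov k.+1 <= U)%VS.
Proof.
move=> vU LU; rewrite /= subv_add -memvE vU; apply/subvP => _ /memv_imgP[x xk ->].
exact: LU.
Qed.

End Krylov.

Section ConjugateGradient.
Variables (R : realType) (W : vectType R).
Variables (S : 'Hom(dual W, W)) (A : 'Hom(W, dual W)).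
Hypotheses (S_spd : spd_op S) (Asym : sym_form A) (Apos : posdef_form A).
Variables (g : dual W) (u0 : W).

Let z0 := S (g - A u0).

(** [K] stands for the span of the first [k] search directions. Orthogonality
    of the residual and conjugacy of the new direction to [K] are what the
    coefficients alpha and beta are chosen for; [inv_seed] and [inv_stable]
    make [K] grow at least as fast as the Krylov spaces. *)
Record pcg_invariant (k : nat) (s : pcg_state W) (K : {vspace W}) : Prop :=
  PCGInvariant {
    inv_r : pcg_r s = g - A (pcg_u s);
    inv_z : pcg_z s = S (pcg_r s);
    inv_u : pcg_u s - u0 \in K;
    inv_zp : pcg_z s - pcg_p s \in K;
    inv_orth : {in K, forall v, pairing (pcg_r s) v = 0};
    inv_conj : {in K, forall v, pairing (A (pcg_p s)) v = 0};
    inv_seed : z0 \in (K + <[pcg_p s]>)%VS;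
    inv_stable : {in K, forall v, S (A v) \in K + <[pcg_p s]>}%VS;
    inv_krylov : (krylov (S \o A)%VF z0 k <= K)%VS
  }.

Lemma pcg_invariant_init : pcg_invariant 0 (pcg_init S A g u0) 0%VS.
Proof.
split=> //=; rewrite ?subrr ?mem0v //.
- by move=> v; rewrite memv0 => /eqP->; rewrite pairing0r.
- by move=> v; rewrite memv0 => /eqP->; rewrite pairing0r.
- by rewrite add0v memv_line.
- by move=> v; rewrite memv0 => /eqP->; rewrite !linear0 mem0v.
Qed.

(** The new space is [K] plus the current direction [p]. Conjugacy of the next
    direction to the old [K] costs nothing: [<A z', v> = <r', S A v>] by
    symmetry of [A] and [S], and [S A v] already lies in the new space. *)
Lemma pcg_invariant_step k s K : pcg_invariant k s K -> pcg_r s != 0 ->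
  pcg_invariant k.+1 (pcg_step S A s) (K + <[pcg_p s]>)%VS.
Proof.
case: s => u r z p [/= rE zE uK zpK orth conj seed stable kry] r_neq0.
rewrite /pcg_step (negPf r_neq0) /=.
set K' := (K + <[p]>)%VS.
have KK' : {subset K <= K'} by apply/subvP/addvSl.
have pK' : p \in K' by apply: (subvP (addvSr _ _)); apply: memv_line.
have zK' : z \in K' by rewrite -(subrK p z) rpredD // KK'.
have rz_gt0 : 0 < pairing r z by rewrite zE; apply: S_spd.2.
have rpE : pairing r p = pairing r z.
  by apply/esym/subr0_eq; rewrite -pairingNr -pairingDr orth.
have p_neq0 : p != 0.
  by apply: contraTneq rz_gt0 => p0; rewrite -rpE p0 pairing0r ltxx.
have App_gt0 := Apos p_neq0.
set alpha := pairing r z / pairing (A p) p.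
have alpha_neq0 : alpha != 0 by rewrite mulf_neq0 ?invr_eq0 ?gt_eqF.
set r' := r - alpha *: A p; set z' := S r'.
set beta := pairing r' z' / pairing r z; set p' := z' + beta *: p.
(* As [alpha] is nonzero, [S A p] is a combination of the two preconditioned
   residuals, so the spaces keep absorbing images under [S A]. *)
have SAp : S (A p) = alpha^-1 *: (z - z').
  by rewrite zE /z' -linearB opprB addrC subrK linearZ scalerA mulVf ?scale1r.
have p'K : p' \in (K' + <[p']>)%VS.
  by apply: (subvP (addvSr _ _)); apply: memv_line.
have K'S : {subset K' <= (K' + <[p']>)%VS} by apply/subvP/addvSl.
have orth' : {in K', forall v, pairing r' v = 0}.
  move=> _ /memv_addP[v vK [_ /vlineP[c ->] ->]].
  rewrite !pairingE orth // conj // rpE /alpha.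
  by field; rewrite gt_eqF.
have z'K : z' \in (K' + <[p']>)%VS.
  by rewrite -(addrK (beta *: p) z') -/p' rpredB // rpredZ // K'S.
split=> //=.
- by rewrite /r' rE (linearD A) [in RHS]linearZ /= opprD addrA.
- by rewrite addrAC rpredD ?rpredZ // KK'.
- by rewrite /p' opprD addrA subrr sub0r rpredN rpredZ.
- move=> _ /memv_addP[v vK [_ /vlineP[c ->] ->]].
  have conj_v : pairing (A p') v = 0.
    rewrite /p' linearD linearZ /= !pairingE conj // mulr0 addr0 Asym.
    by rewrite /z' S_spd.1 orth' // stable.
  have conj_p : pairing (A p') p = 0.
    have Apz' : pairing (A p) z' = - (alpha^-1 * pairing r' z').
      by rewrite S_spd.1 SAp pairingZr pairingDr pairingNr orth' // sub0r mulrN.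
    have -> : A p' = A z' + beta *: A p by rewrite linearD linearZ.
    rewrite pairingDl pairingZl Asym Apz'.
    by rewrite /beta /alpha; field; rewrite !gt_eqF.
  by rewrite pairingDr pairingZr conj_v conj_p mulr0 addr0.
- exact: K'S.
- move=> _ /memv_addP[v vK [_ /vlineP[c ->] ->]].
  rewrite !linearD !linearZ /= rpredD //; first by apply/K'S/stable.
  by rewrite SAp !rpredZ // rpredB // K'S.
- apply: krylovS_sub => // x xk; rewrite comp_lfunE.
  exact/stable/(subvP kry).
Qed.

(** After a breakdown the invariant need not persist, but then the residual of the
    frozen iterate vanishes and the iterate is the solution. *)
Lemma pcg_iter_invariant m (s := iter m (pcg_step S A) (pcg_init S A g u0)) :
  (pcg_r s = 0 /\ pcg_r s = g - A (pcg_u s)) \/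
  exists K, pcg_invariant m s K.
Proof.
rewrite {}/s; elim: m => [|m IHm] /=; first by right; exists 0%VS;
  apply: pcg_invariant_init.
set s := iter m _ _ in IHm *.
have frozen : pcg_r s = 0 -> pcg_step S A s = s.
  by case: s {IHm} => u r z p /= ->; rewrite eqxx.
have [r0|r_neq0] := eqVneq (pcg_r s) 0.
  left; rewrite frozen //; split=> //; case: IHm => [[] //|[K inv]].
  exact: inv_r inv.
case: IHm => [[r0]|[K inv]]; first by rewrite r0 eqxx in r_neq0.
by right; exists (K + <[pcg_p s]>)%VS; apply: pcg_invariant_step.
Qed.

(** The residual [A (ut - u_m)] annihilates [K], so [ut - u_m] is the
    energy-orthogonal projection of every [y] in the coset [ut - u_m + K],
    which contains [ut - u0] plus the Krylov space. *)
Lemma pcg_error_min m (ut y : W) : A ut = g ->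
  y - (ut - u0) \in krylov (S \o A)%VF (S (A (ut - u0))) m ->
  pairing (A (ut - pcg S A m g u0)) (ut - pcg S A m g u0) <= pairing (A y) y.
Proof.
move=> utE; have <- : z0 = S (A (ut - u0)) by rewrite linearB /= utE.
rewrite /pcg; case: (pcg_iter_invariant m); set s := iter m _ _.
  case=> -> /esym; rewrite -utE -linearB /= => -> _.
  by rewrite pairing0l posdef_psd.
case=> K inv yK; set e := ut - pcg_u s.
have Ae : A e = pcg_r s by rewrite /e linearB /= utE (inv_r inv).
have dK : y - e \in K.
  have -> : y - e = (y - (ut - u0)) + (pcg_u s - u0).
    by apply: pairing_separates => h; rewrite /e !pairingE; ring.
  by rewrite rpredD ?(inv_u inv) // (subvP (inv_krylov inv)).
clearbody e; rewrite -(subrK e y); move: (y - e) dK => d dK.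
have Aed : pairing (A e) d = 0 by rewrite Ae (inv_orth inv).
rewrite linearD /= !pairingE (Asym d e) Aed !addr0 add0r lerDr.
exact: posdef_psd.
Qed.

End ConjugateGradient.

(** * Chebyshev polynomials of an operator *)

Section Chebyshev.
Variables (R : realType) (W : vectType R) (Y : 'End(W)) (e : W).

(** With [Y] in the role of [x^2], the pair holds [T_(2k+1)(x) / x] and
    [U_(2k)(x)] applied to [e]. One step is the addition formula for the angle
    increment [2 theta], where [x = cos theta]: the odd parity of [T_(2k+1)] and
    the even parity of [U_(2k)] leave only polynomials in [x^2]. *)
Definition cheb_step (tw : W * W) : W * W :=
  let: (t, w) := tw in
  (2 *: Y t - t - 2 *: (w - Y w), 2 *: Y w - w + 2 *: Y t).

Definition cheb (k : nat) : W * W := iter k cheb_step (e, e).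

(** The seed components are the values at [0] of the two polynomials, namely
    [(-1)^k (2k+1)] and [(-1)^k]; the remainder is a combination of
    [Y e, ..., Y^k e]. A chain of spaces [F] is used instead of the Krylov
    spaces of [Y] because [Y] will be a multiple of the operator whose Krylov
    spaces are known. *)
Lemma cheb_sub_seed (F : nat -> {vspace W}) k :
  (forall j, F j <= F j.+1)%VS -> (forall j, {in F j, forall v, Y v \in F j.+1}) ->
  Y e \in F 1%N ->
  (cheb k).1 - ((-1) ^+ k * (2 * k + 1)%:R) *: e \in F k /\
  (cheb k).2 - (-1) ^+ k *: e \in F k.
Proof.
move=> Fmono FY Ye; elim: k => [|k].
  rewrite muln0 /= expr0 mul1r mulr1n !scale1r subrr; split; apply: mem0v.
have YeS : Y e \in F k.+1.
  by elim: k => // k; apply: (subvP (Fmono _)).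
rewrite /cheb iterS -/(cheb k); case: (cheb k) => t w /= [].
set c := (-1) ^+ k * _; set d := (-1) ^+ k => tF wF.
set t0 := t - c *: e in tF; set w0 := w - d *: e in wF.
have tE : t = t0 + c *: e by rewrite subrK.
have wE : w = w0 + d *: e by rewrite subrK.
have t0F := subvP (Fmono k) _ tF; have w0F := subvP (Fmono k) _ wF.
have Yt0F := FY _ _ tF; have Yw0F := FY _ _ wF.
have Yt : Y t \in F k.+1 by rewrite tE linearD linearZ rpredD ?rpredZ.
have Yw : Y w \in F k.+1 by rewrite wE linearD linearZ rpredD ?rpredZ.
split.
  have -> : 2 *: Y t - t - 2 *: (w - Y w) -
      ((-1) ^+ k.+1 * (2 * k.+1 + 1)%:R) *: e =
      2 *: Y t - t0 - 2 *: w0 + 2 *: Y w.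
    have -> : (-1) ^+ k.+1 * (2 * k.+1 + 1)%:R = - c - 2 * d.
      by rewrite /c /d exprS mulnS !natrD; ring.
    by apply: pairing_separates => g; rewrite /t0 /w0 !pairingE; ring.
  by clearbody t0 w0; do ?[apply: rpredB | apply: rpredD | apply: rpredZ].
have -> : 2 *: Y w - w + 2 *: Y t - (-1) ^+ k.+1 *: e =
    2 *: Y w - w0 + 2 *: Y t.
  by apply: pairing_separates => g; rewrite /w0 /d exprS !pairingE; ring.
by clearbody t0 w0; do ?[apply: rpredB | apply: rpredD | apply: rpredZ].
Qed.

(** The Pell identity [x^2 (T_(2k+1)(x) / x)^2 + (1 - x^2) U_(2k)(x)^2 = 1]. The
    addition formula preserves it, as a rotation preserves
    [cos^2 + sin^2 = 1]. Self-adjointness of [Y] lets the moments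
    [<T Y^i x, y>] stand in for the products of scalars. *)
Lemma cheb_energy (T : 'Hom(W, dual W)) k : sym_form T ->
  (forall v w, pairing (T (Y v)) w = pairing (T v) (Y w)) ->
  let: (t, w) := cheb k in
  pairing (T (Y t)) t + (pairing (T w) w - pairing (T (Y w)) w) =
  pairing (T e) e.
Proof.
move=> Tsym TY.
have YD v w : Y (v + w) = Y v + Y w := linearD Y v w.
have YN v : Y (- v) = - Y v := linearN Y v.
have YZ c v : Y (c *: v) = c *: Y v by rewrite linearZ.
have TD v w : T (v + w) = T v + T w := linearD T v w.
have TN v : T (- v) = - T v := linearN T v.
have TZ c v : T (c *: v) = c *: T v by rewrite linearZ.
elim: k => [|k]; first by rewrite /=; ring.
rewrite /cheb iterS -/(cheb k); case: (cheb k) => t w /= <-.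
rewrite !(YD, YN, YZ) !(TD, TN, TZ) !pairingE.
(* Bring every moment to the form [<T Y^i x, y>], then order [x] and [y]. *)
rewrite -!TY.
have swap1 : pairing (T (Y w)) t = pairing (T (Y t)) w by rewrite TY Tsym.
have swap2 : pairing (T (Y (Y w))) t = pairing (T (Y (Y t))) w.
  by rewrite Tsym !TY.
have swap3 : pairing (T (Y (Y (Y w)))) t = pairing (T (Y (Y (Y t)))) w.
  by rewrite Tsym !TY.
by rewrite swap1 swap2 swap3; ring.
Qed.

End Chebyshev.

(** * Convergence of the iteration *)

Section PcgBound.
Variables (R : realType) (W : vectType R).
Variables (S : 'Hom(dual W, W)) (A : 'Hom(W, dual W)).
Hypotheses (S_spd : spd_op S) (Asym : sym_form A) (Apos : posdef_form A).
Variable lambda : R.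
Hypothesis A_le : forall v, pairing (A v) v <= lambda * pairing ((S^-1)%VF v) v.

(** The competitor in the optimality property is the first Chebyshev vector
    divided by its seed coefficient [(-1)^m (2m+1)]. *)
Lemma pcg_energy_bound m (g : dual W) (u0 ut : W)
    (e := ut - u0) (em := ut - pcg S A m g u0) : A ut = g ->
  pairing (A em) em <=
    lambda / (2 * m + 1)%:R ^+ 2 * pairing ((S^-1)%VF e) e.
Proof.
(* If [e = 0] the space may be trivial and [lambda] need not be positive. *)
move=> utE; have [e0|e_neq0] := eqVneq e 0.
  have := @pcg_error_min _ _ S A S_spd Asym Apos g u0 m ut e utE.
  by rewrite subrr mem0v e0 !pairing0r mulr0; apply.
have T_gt0 := spd_inv_posdef S_spd e_neq0.
have lambda_gt0 : 0 < lambda.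
  by have := lt_le_trans (Apos e_neq0) (A_le e); rewrite pmulr_lgt0.
pose T := (S^-1)%VF; pose Y := lambda^-1 *: (S \o A)%VF.
have TYE v w : pairing (T (Y v)) w = lambda^-1 * pairing (A v) w.
  by rewrite scale_lfunE comp_lfunE linearZ /= (spd_opK S_spd) pairingZl.
have Tsym : sym_form T := spd_inv_sym S_spd.
have TYsym v w : pairing (T (Y v)) w = pairing (T v) (Y w).
  by rewrite TYE Asym -TYE Tsym.
pose F := krylov (S \o A)%VF (S (A e)).
have FY j : {in F j, forall v, Y v \in F j.+1}.
  by move=> v vF; rewrite scale_lfunE rpredZ // krylov_stable.
have Ye : Y e \in F 1%N.
  by rewrite scale_lfunE rpredZ // comp_lfunE krylov_seed.
have [tF _] := cheb_sub_seed m (@krylovS _ _ _ _) FY Ye.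
have := cheb_energy e m Tsym TYsym.
case: (cheb Y e m) tF => t w /=; set c := (-1) ^+ m * _ => tF energy.
have n_gt0 : 0 < (2 * m + 1)%:R :> R by rewrite ltr0n addn1.
have c2 : c ^+ 2 = (2 * m + 1)%:R ^+ 2 by rewrite exprMn sqrr_sign mul1r.
have c_neq0 : c != 0 by rewrite -sqrf_eq0 c2 sqrf_eq0 gt_eqF.
have t_le : pairing (A t) t <= lambda * pairing (T e) e.
  rewrite -energy -ler_pdivrMl // -TYE lerDl subr_ge0 TYE ler_pdivrMl //.
have yF : c^-1 *: t - e \in F m.
  by rewrite -{1}(scalerK c_neq0 e) -scalerBr rpredZ.
apply: le_trans (pcg_error_min S_spd Asym Apos utE yF) _.
rewrite linearZ /= pairingZl pairingZr mulrA -expr2 exprVn c2 mulrC mulrAC.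
by rewrite ler_wpM2r // invr_ge0 ltW // exprn_gt0.
Qed.

End PcgBound.

(** Insert [y] between [u] and [x], contract, and then insert [u] between [y]
    and [z]. *)
Lemma extended_triangle (R : realType) (W X : lmodType R)
    (iota : {linear W -> X}) (u : X) (N : X -> R) (eps : R) (x y z : W) :
  seminorm_on (add_span iota u) N -> 0 <= eps ->
  N (iota (y - x)) <= eps * N (iota (y - z)) ->
  N (u - iota x) <= (1 + eps) * N (u - iota y) + eps * N (u - iota z).
Proof.
move=> [Ntri Nhom] eps_ge0 contr.
have spanW v : add_span iota u (iota v) by exists v, 0; rewrite scale0r addr0.
have spanB v : add_span iota u (u - iota v).
  by exists (- v), 1; rewrite scale1r linearN addrC.
have split_x : N (u - iota x) <= N (u - iota y) + N (iota (y - x)).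
  have -> : u - iota x = (u - iota y) + iota (y - x).
    by rewrite linearB addrA subrK.
  exact: (Ntri _ _ (spanB y) (spanW (y - x))).
have split_yz : N (iota (y - z)) <= N (u - iota y) + N (u - iota z).
  have -> : iota (y - z) = -1 *: (u - iota y) + (u - iota z).
    by rewrite linearB scaleN1r opprB addrA subrK.
  have <- : N (-1 *: (u - iota y)) = N (u - iota y).
    by rewrite (Nhom _ _ (spanB y)) normrN1 mul1r.
  apply: (Ntri _ _ _ (spanB z)).
  by exists y, (-1); rewrite !scaleN1r opprB.
have := ler_wpM2l eps_ge0 split_yz.
by move: split_x contr; lra.
Qed.

Theorem theorem2p5 (R : realType)
    (* the finite element spaces V <= Vt *)
    (Vt : vectType R) (V : {vspace Vt}) (a : {dot Vt for idfun})
    (f : dual (subvs_of V)) (ft : dual Vt)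
    (ft_restr : forall v : subvs_of V, pairing ft (vsval v) = pairing f v)
    (uh : Vt) (uh_in : uh \in V)
    (uh_sol : forall v : subvs_of V, a uh (vsval v) = pairing f v)
    (ut : Vt) (ut_sol : forall v : Vt, a ut v = pairing ft v)
    (* u lives in a space X containing Vt; N is the extended seminorm *)
    (X : lmodType R) (iota : {linear Vt -> X}) (iota_inj : injective iota)
    (u : X) (N : X -> R)
    (N_seminorm : seminorm_on (add_span iota u) N)
    (N_energy : forall v : Vt, N (iota v) = energy_norm a v)
    (S : 'Hom(dual Vt, Vt)) (S_spd : spd_op S)
    (lambda : R) (hlambda : lambda_max (S \o energy_op a)%VF <= lambda)
    (delta : R) (delta_gt0 : 0 < delta)
    (hdelta : precond_norm S (ut - uh)
              <= Num.sqrt delta * energy_norm a (ut - uh))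
    (m : nat) (m_ge1 : (1 <= m)%N) :
  let Rmuh := pcg S (energy_op a) m ft uh in
  let eps := pcg_eps lambda delta m in
  N (u - iota Rmuh) <= (1 + eps) * N (u - iota ut) + eps * N (u - iota uh).

Proof.
cbv zeta; set A := energy_op a.
set Rmuh := pcg _ _ _ _ _; set eps := pcg_eps _ _ _.
have AE v w : pairing (A v) w = a v w := energy_opE a v w.
have Asym : sym_form A by move=> v w; rewrite !AE hermC expr0 mul1r.
have Apos : posdef_form A by move=> v v_neq0; rewrite AE neq0_dnorm_gt0.
have utE : A ut = ft.
  by apply/lfunP => v; have := AE ut v; rewrite ut_sol.
have A_le v : pairing (A v) v <= lambda * pairing ((S^-1)%VF v) v.
  apply: le_trans (form_le_lambda_max S_spd v Asym) _.
  by rewrite ler_wpM2r // (posdef_psd (spd_inv_posdef S_spd)).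
have n_gt0 : 0 < (2 * m + 1)%:R :> R by rewrite ltr0n addn1.
have eps_ge0 : 0 <= eps by rewrite divr_ge0 ?sqrtr_ge0 ?ltW.
apply: extended_triangle N_seminorm eps_ge0 _; rewrite !N_energy.
have := pcg_energy_bound S_spd Asym Apos A_le m uh utE.
rewrite -/Rmuh; set em := ut - Rmuh; set e := ut - uh in hdelta *.
have Apsd := posdef_psd Apos; have Tpsd := posdef_psd (spd_inv_posdef S_spd).
rewrite AE => em_le.
have aee_ge0 : 0 <= a e e by rewrite -AE.
have Te_le : pairing ((S^-1)%VF e) e <= delta * a e e.
  move: hdelta; rewrite /precond_norm /energy_norm -(sqrtrM _ (ltW delta_gt0)).
  by rewrite ler_sqrt // mulr_ge0 // ltW.
have lambdaTe_le : lambda * pairing ((S^-1)%VF e) e <= lambda * delta * a e e.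
  have [->|e_neq0] := eqVneq e 0; first by rewrite -AE !pairing0r !mulr0.
  rewrite -mulrA ler_wpM2l // -(pmulr_lge0 _ (spd_inv_posdef S_spd e_neq0)).
  exact: le_trans (Apsd e) (A_le e).
rewrite /energy_norm /eps /pcg_eps mulrAC ler_pdivlMr //.
rewrite mulrC (mulrC (Num.sqrt _)) -sqrtrM // -[X in X * _](ger0_norm (ltW n_gt0)).
rewrite -sqrtr_sqr -sqrtrM ?sqr_ge0 // ler_wsqrtr // mulrC -ler_pdivlMr ?exprn_gt0 //.
apply: le_trans em_le _; rewrite mulrAC ler_wpM2r ?invr_ge0 ?sqr_ge0 //.
by rewrite [leRHS]mulrC.
Qed.
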